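(* Let $\Sigma$ be an alphabet and consider the system model $(2^{\Sigma^\omega},\subseteq,\emptyset,\Sigma^\omega)$ with the test setups $\mathbf{T}_*$ and $\mathbf{T}_r$ defined in the context. Then: (1) a temporal property $\phi\subseteq\Sigma^\omega$ is $\mathbf{T}_*$-refutable if and only if $\phi$ is safety; (2) every temporal property $\phi\subseteq\Sigma^\omega$ is $\mathbf{T}_r$-refutable; (3) every $\mathbf{T}_*$-verifiable temporal property $\phi\subseteq\Sigma^\omega$ is trivial.
   Context: $\Sigma^\omega$ is the set of countably infinite sequences over $\Sigma$ and $\Sigma^*$ the set of finite sequences over $\Sigma$. Systems are subsets $S\subseteq\Sigma^\omega$, so the set of systems is $\mathfrak{D}=2^{\Sigma^\omega}$, ordered by inclusion. A requirement is a set $R\subseteq\mathfrak{D}$ of systems; it is trivial if $R=\emptyset$ or $R=\mathfrak{D}$. A temporal property is a subset $\phi\subseteq\Sigma^\omega$. It defines the requirement $R_\phi=\{S\subseteq\Sigma^\omega\mid S\subseteq\phi\}$; a property $\phi$ is said to be refutable, verifiable, or trivial when the requirement $R_\phi$ is. The property $\phi$ is safety if for every $\pi\in\Sigma^\omega\setminus\phi$ there is a finite prefix $\sigma$ of $\pi$ such that $\sigma\pi'\notin\phi$ for all $\pi'\in\Sigma^\omega$ (juxtaposition denotes concatenation). A test setup is a pair $\mathbf{T}=(T,\alpha)$ where $T$ is a set and $\alpha:\mathfrak{D}\to 2^T$ satisfies $S\subseteq S'\Rightarrow\alpha(S)\subseteq\alpha(S')$. For $t\in T$, $\hat\alpha(t)=\{S\in\mathfrak{D}\mid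 t\in\alpha(S)\}$. A requirement $R$ is $\mathbf{T}$-refutable if for every $S\in\mathfrak{D}$ with $S\notin R$ there exists $t\in\alpha(S)$ with $\hat\alpha(t)\cap R=\emptyset$. It is $\mathbf{T}$-verifiable if for every $S\in R$ there exists $t\in\alpha(S)$ with $\hat\alpha(t)\subseteq R$. $\mathbf{T}_r=(\mathfrak{D},\lfloor\cdot\rfloor)$, where $\lfloor S\rfloor=\{S'\in\mathfrak{D}\mid S'\subseteq S\}$. $\mathbf{T}_*=(T_*,\alpha_* )$, where $T_*$ is the set of all finite subsets of $\Sigma^*$ and $\alpha_*(S)$ is the set of all finite subsets of $\bigcup_{\pi\in S}\mathit{pre}(\pi)$, with $\mathit{pre}(\pi)\subseteq\Sigma^*$ the set of all finite prefixes of $\pi$. *)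

(* Defs.v *)
From mathcomp Require Import all_boot.
From mathcomp Require Import boolp classical_sets functions cardinality.

Set Implicit Arguments.
Unset Strict Implicit.
Unset Printing Implicit Defensive.

Local Open Scope classical_set_scope.

Definition omega_word (Sigma : Type) : Type := nat -> Sigma.

Definition system (Sigma : Type) : Type := set (omega_word Sigma).

Definition requirement (Sigma : Type) : Type := set (system Sigma).

Definition property (Sigma : Type) : Type := set (omega_word Sigma).

Record test_setup (Sigma : Type) : Type := TestSetup {
  test : Type;
  alpha : system Sigma -> set test;
  alpha_mono : forall S S' : system Sigma, S `<=` S' -> alpha S `<=` alpha S'
}.

Arguments alpha {Sigma} t _ .
Arguments test {Sigma} t .

Section Requirements.
Variable Sigma : Type.
Implicit Types (R : requirement Sigma) (phi : property Sigma)
  (T : test_setup Sigma).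

Definition alpha_hat T (t : test T) : set (system Sigma) :=
  [set S | alpha T S t].

Definition refutable T R : Prop :=
  forall S : system Sigma, ~ R S ->
    exists2 t : test T, alpha T S t & alpha_hat t `&` R = set0.

Definition verifiable T R : Prop :=
  forall S : system Sigma, R S ->
    exists2 t : test T, alpha T S t & alpha_hat t `<=` R.

Definition trivial_requirement R : Prop := R = set0 \/ R = setT.

Definition requirement_of phi : requirement Sigma :=
  [set S : system Sigma | S `<=` phi].

Definition property_refutable T phi : Prop := refutable T (requirement_of phi).

Definition property_verifiable T phi : Prop :=
  verifiable T (requirement_of phi).

Definition property_trivial phi : Prop :=
  trivial_requirement (requirement_of phi).

(* [mkseq pi n] is the prefix of [pi] of length [n]; the empty one is included. *)
Definition pre (pi : omega_word Sigma) : set (seq Sigma) := range (mkseq pi).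

(* The default [pi 0] of [nth] is never reached. *)
Definition concat (sigma : seq Sigma) (pi : omega_word Sigma) :
    omega_word Sigma :=
  fun n => if n < size sigma then nth (pi 0) sigma n else pi (n - size sigma).

Definition safety phi : Prop :=
  forall pi : omega_word Sigma, ~ phi pi ->
    exists2 sigma : seq Sigma, pre pi sigma &
      forall pi' : omega_word Sigma, ~ phi (concat sigma pi').

Definition alpha_r (S : system Sigma) : set (system Sigma) :=
  [set S' : system Sigma | S' `<=` S].

Lemma alpha_r_mono (S S' : system Sigma) :
  S `<=` S' -> alpha_r S `<=` alpha_r S'.
Proof. by move=> SS' S0 /= S0S; apply: subset_trans SS'. Qed.

Definition test_star : Type := {t : set (seq Sigma) | finite_set t}.

Definition alpha_star (S : system Sigma) : set test_star :=
  [set t : test_star | sval t `<=` \bigcup_(pi in S) pre pi].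

Lemma alpha_star_mono (S S' : system Sigma) :
  S `<=` S' -> alpha_star S `<=` alpha_star S'.
Proof.
by move=> SS' t /= tS; apply: subset_trans tS _; apply: bigcup_subset.
Qed.

End Requirements.

Definition T_r (Sigma : Type) : test_setup Sigma :=
  TestSetup (@alpha_r_mono Sigma).

Definition T_star (Sigma : Type) : test_setup Sigma :=
  TestSetup (@alpha_star_mono Sigma).

(* Main.v *)
Require Import Defs.
From mathcomp Require Import all_boot.
From mathcomp Require Import boolp classical_sets functions cardinality.

Set Implicit Arguments.
Unset Strict Implicit.
Unset Printing Implicit Defensive.

Local Open Scope classical_set_scope.

(** A finite set of prefixes of a single word [pi] says no more than one sufficiently long prefix of
    [pi], and conversely one bad prefix is already a test. Hence [T_star]-refutation amounts to
    safety ([star_refutable_safety], [safety_star_refutable]). The other two claims hold because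
    [requirement_of phi] is closed under subsystems: a violating system stays violating when
    enlarged, and the empty system always satisfies [phi]. *)

Lemma finite_set_nat_bounded (A : set nat) :
  finite_set A -> exists n, forall k, A k -> k <= n.
Proof.
move=> /finite_seqP[s ->]; exists (\max_(i <- s) i) => k ks.
exact: leq_bigmax_seq.
Qed.

Lemma mkseq_concat (Sigma : Type) (pi pi' : omega_word Sigma) (n k : nat) :
  k <= n -> mkseq (concat (mkseq pi n) pi') k = mkseq pi k.
Proof.
move=> kn; apply: (@eq_from_nth _ (pi 0)); rewrite !size_mkseq // => i ik.
rewrite !nth_mkseq // /concat size_mkseq.
by rewrite (leq_trans ik kn) nth_mkseq // (leq_trans ik kn).
Qed.

Lemma concat_mkseq_shift (Sigma : Type) (pi : omega_word Sigma) (n : nat) :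
  concat (mkseq pi n) (fun i => pi (n + i)) = pi.
Proof.
apply/funext => i; rewrite /concat size_mkseq.
by case: ltnP => [lt_in|le_ni]; rewrite ?nth_mkseq ?subnKC.
Qed.

Lemma star_refutable_safety (Sigma : Type) (phi : property Sigma) :
  property_refutable (T_star Sigma) phi -> safety phi.
Proof.
move=> ref pi npi.
(* On a singleton system, all words of the test are prefixes of the same [pi]. *)
have [|[t fin_t] /= t_pi t_phi] := ref [set pi]; first by move=> /(_ pi erefl).
have [n len_t] := finite_set_nat_bounded (finite_image size fin_t).
exists (mkseq pi n); first by exists n.
move=> pi' phi_pi'.
(* As [n] bounds the lengths in [t], this one-word system also passes [t]; yet it would satisfy
   [phi]. *)
suff : set0 [set concat (mkseq pi n) pi'] by [].
rewrite -t_phi; split=> [sigma t_sigma|_ -> //].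
exists (concat (mkseq pi n) pi') => //.
have [_ -> [k _ def_sigma]] := t_pi _ t_sigma.
exists k => //; rewrite mkseq_concat // -(size_mkseq pi k) def_sigma.
by apply: len_t; exists sigma.
Qed.

Lemma safety_star_refutable (Sigma : Type) (phi : property Sigma) :
  safety phi -> property_refutable (T_star Sigma) phi.
Proof.
move=> safe S /existsNP[pi /not_implyP[S_pi npi]].
have [sigma pre_sigma bad_sigma] := safe pi npi.
exists (exist _ [set sigma] (finite_set1 sigma)) => /=.
  by move=> _ ->; exists pi.
apply/seteqP; split=> // S' [/(_ sigma erefl)[pi' S'_pi' [k _ def_sigma]] S'phi].
(* The tail of [pi'] after its prefix [sigma] of length [k] turns [pi'] into a continuation of
   [sigma]. *)
apply: (bad_sigma (fun i => pi' (k + i))).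
by rewrite -def_sigma concat_mkseq_shift; apply: S'phi.
Qed.

(** The violating system serves as its own test: every system admitting it contains it. *)
Lemma r_refutable (Sigma : Type) (phi : property Sigma) :
  property_refutable (T_r Sigma) phi.
Proof.
move=> S nS; exists S => //.
by apply/seteqP; split=> // S' [SS' S'phi]; apply/nS/(subset_trans SS').
Qed.

(* The empty system satisfies [phi], and its only test, the empty one, is a
   test of every system. *)
Lemma star_verifiable_trivial (Sigma : Type) (phi : property Sigma) :
  property_verifiable (T_star Sigma) phi -> property_trivial phi.
Proof.
move=> /(_ set0 (@sub0set _ _))[t t0 t_phi]; right.
apply/seteqP; split=> // S _; apply: t_phi.
exact: (alpha_mono (@sub0set _ S) t0).
Qed.

Theorem lemma7 (Sigma : Type) :
  (forall phi : property Sigma,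
     property_refutable (T_star Sigma) phi <-> safety phi) /\
  (forall phi : property Sigma, property_refutable (T_r Sigma) phi) /\
  (forall phi : property Sigma,
     property_verifiable (T_star Sigma) phi -> property_trivial phi).
Proof.
split=> [phi|].
  by split; [exact: star_refutable_safety|exact: safety_star_refutable].
by split=> phi; [exact: r_refutable|exact: star_verifiable_trivial].
Qed.
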